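(* Let $x_0\in(0,\pi/2)$ and put $b=-\dfrac{1}{x_0^2}\log\dfrac{x_0}{\tan x_0}$. Then for every $x\in(0,x_0)$ the following inequalities hold: $$e^{-bx^2}<\frac{x}{\tan x}<e^{-x^2/3},$$ and the constants $b$ and $1/3$ are the best possible; that is, $b$ is the smallest real number $\beta$ such that $e^{-\beta x^2}<\frac{x}{\tan x}$ for all $x\in(0,x_0)$, and $1/3$ is the largest real number $\gamma$ such that $\frac{x}{\tan x}<e^{-\gamma x^2}$ for all $x\in(0,x_0)$.
   Context: $\log$ denotes the natural logarithm. *)

(* Defs.v *)
From Stdlib Require Import Reals.
Local Open Scope R_scope.

Definition is_least (E : R -> Prop) (m : R) : Prop :=
  E m /\ (forall y : R, E y -> m <= y).

Definition is_greatest (E : R -> Prop) (m : R) : Prop :=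
  E m /\ (forall y : R, E y -> y <= m).

(* Main.v *)
Require Import Defs.
From Stdlib Require Import Reals Lra.
From Coquelicot Require Import Coquelicot.
Open Scope R_scope.

(** Write [f x = ln (tan x / x)].  Since [x / tan x = exp (- f x)], the
    inequality [exp (- c x^2) < x / tan x] says [f x / x^2 < c], and the reverse
    inequality says [c < f x / x^2].  The theorem is therefore that
    [f x / x^2] has infimum [1/3] and supremum [b = f x0 / x0^2] on [(0, x0)],
    neither being attained.

    The supremum comes from strict monotonicity on [(0, PI/2)]
    ([tanc_exponent_increasing]) and continuity at [x0].  The derivative of
    [f x / x^2] has the sign of [x f' x - 2 f x], which tends to [0] at [0]; its
    own derivative is, with [t = 2 x], a positive multiple of
    [2 sin^2 t - t sin t - t^2 cos t], and this is positive on [(0, PI)]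
    ([sin_quadratic_pos]).

    The infimum comes from two Taylor estimates: [f x > x^2 / 3]
    ([ln_tanc_lower]), again by differentiation, and an upper bound for [f]
    which agrees with [x^2 / 3] to leading order ([ln_tanc_upper]). *)

(** * Taylor bounds for sine and cosine *)

Lemma sin_lower3 t : 0 <= t <= 4 -> t - t ^ 3 / 6 <= sin t.
Proof.
intros Ht; destruct (pre_sin_bound t 0) as [H _]; try lra.
apply Rle_trans with (2 := H), Req_le.
unfold sin_approx, sin_term; simpl; field.
Qed.

Lemma sin_upper5 t : 0 <= t <= 4 -> sin t <= t - t ^ 3 / 6 + t ^ 5 / 120.
Proof.
intros Ht; destruct (pre_sin_bound t 0) as [_ H]; try lra.
apply Rle_trans with (1 := H), Req_le.
unfold sin_approx, sin_term; simpl; field.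
Qed.

Lemma cos_lower2 t : -2 <= t <= 2 -> 1 - t ^ 2 / 2 <= cos t.
Proof.
intros Ht; destruct (pre_cos_bound t 0) as [H _]; try lra.
apply Rle_trans with (2 := H), Req_le.
unfold cos_approx, cos_term; simpl; field.
Qed.

Lemma cos_upper4 t : -2 <= t <= 2 -> cos t <= 1 - t ^ 2 / 2 + t ^ 4 / 24.
Proof.
intros Ht; destruct (pre_cos_bound t 0) as [_ H]; try lra.
apply Rle_trans with (1 := H), Req_le.
unfold cos_approx, cos_term; simpl; field.
Qed.

(** Otherwise [cos (9/5)] would be nonnegative, against the quartic bound. *)
Lemma PI2_upper : PI / 2 < 9 / 5.
Proof.
apply Rnot_le_lt; intros H.
assert (0 <= cos (9 / 5)) by (apply cos_ge_0; lra).
assert (HC := cos_upper4 (9 / 5)).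
lra.
Qed.

(** Put [u = sin t / t]; the claim is [2 u^2 - u - cos t > 0].  For [t <= 2] the
    bound [u >= 1 - t^2/6 > 1/4] lies where [2 u^2 - u] increases, and
    substituting it together with the quartic bound for the cosine leaves
    exactly [t^4 / 72].  For [t >= 2], [cos t <= cos 2 < -1/8] makes the
    discriminant [1 + 8 cos t] negative. *)
Lemma sin_quadratic_pos t : 0 < t < PI ->
  0 < 2 * sin t ^ 2 - t * sin t - t ^ 2 * cos t.
Proof.
intros [H0 HP].
assert (HPI := PI_4).
set (u := sin t / t).
assert (Hs : sin t = t * u) by (unfold u; field; lra).
rewrite Hs.
replace (2 * (t * u) ^ 2 - t * (t * u) - t ^ 2 * cos t)
  with (t ^ 2 * (2 * u ^ 2 - u - cos t)) by ring.
apply Rmult_lt_0_compat; [nra|].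
destruct (Rle_lt_dec t 2) as [H2|H2].
- assert (HU : 1 - t ^ 2 / 6 <= u).
  { apply Rmult_le_reg_l with t; [lra|]; rewrite <- Hs.
    generalize (sin_lower3 t); lra. }
  assert (HC := cos_upper4 t).
  assert (0 < t ^ 4) by (apply pow_lt; lra).
  assert (1 / 4 <= 1 - t ^ 2 / 6) by nra.
  assert (0 <= (u - (1 - t ^ 2 / 6)) * (2 * (u + (1 - t ^ 2 / 6)) - 1))
    by (apply Rmult_le_pos; lra).
  nra.
- assert (cos t < cos 2) by (apply cos_decreasing_1; lra).
  assert (HC := cos_upper4 2).
  nra.
Qed.

(** * The logarithm of tan x / x and its derivatives *)

Definition ln_tanc (x : R) : R := ln (tan x / x).

(** The derivative of [ln_tanc x - c * x ^ 2]; taking [c = 0] gives that of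
    [ln_tanc] itself. *)
Definition ln_tanc' (c x : R) : R := 1 / (sin x * cos x) - 1 / x - 2 * c * x.

Lemma sin_cos_pos x : 0 < x < PI / 2 -> 0 < sin x /\ 0 < cos x.
Proof.
intros Hx; split; [apply sin_gt_0 | apply cos_gt_0]; lra.
Qed.

Lemma tanc_pos x : 0 < x < PI / 2 -> 0 < tan x / x.
Proof.
intros Hx; apply Rdiv_lt_0_compat; [apply tan_gt_0|]; lra.
Qed.

Lemma inv_tanc_exp x : 0 < x < PI / 2 -> x / tan x = exp (- ln_tanc x).
Proof.
intros Hx; assert (H := tanc_pos x Hx).
unfold ln_tanc; rewrite exp_Ropp, exp_ln by easy.
assert (0 < tan x) by (apply tan_gt_0; lra).
field; lra.
Qed.

Lemma is_derive_ln_tanc c x : 0 < x < PI / 2 ->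
  is_derive (fun y => ln_tanc y - c * y ^ 2) x (ln_tanc' c x).
Proof.
intros Hx; destruct (sin_cos_pos x Hx) as [Hs Hc].
assert (Ht := tanc_pos x Hx).
unfold ln_tanc, ln_tanc', tan in *; auto_derive.
- repeat split; lra.
- assert (E := sin2_cos2 x); unfold Rsqr in E.
  transitivity ((sin x * sin x + cos x * cos x) / (sin x * cos x)
                - 1 / x - 2 * c * x).
  + field; lra.
  + now rewrite E.
Qed.

Lemma derive_pos_increasing (f f' : R -> R) a b :
  (forall x, a < x < b -> is_derive f x (f' x)) ->
  (forall x, a < x < b -> 0 < f' x) ->
  forall x y, a < x -> x < y -> y < b -> f x < f y.
Proof.
intros Hd Hp x y Hx Hxy Hy.
destruct (MVT_cor2 f f' x y Hxy) as [c [Hc Hcxy]].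
- intros c Hc; apply is_derive_Reals, Hd; lra.
- assert (0 < f' c) by (apply Hp; lra).
  nra.
Qed.

(** A one-sided bound [- K y^2] near [0] stands in for the limit [0] at [0], so
    that functions involving [ln (tan x / x)] need no extension to [0]. *)
Lemma increasing_from_zero_pos (f : R -> R) b K d : 0 < d ->
  (forall x y, 0 < x -> x < y -> y < b -> f x < f y) ->
  (forall y, 0 < y < d -> - (K * y ^ 2) <= f y) ->
  forall x, 0 < x < b -> 0 < f x.
Proof.
intros Hd Hinc Hlow x Hx.
(* Strictness comes from comparing with the midpoint x / 2. *)
assert (H1 : f (x / 2) < f x) by (apply Hinc; lra).
apply Rle_lt_trans with (2 := H1).
destruct (Rle_lt_dec 0 (f (x / 2))) as [H|H]; [easy|exfalso].
set (e := - f (x / 2)).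
assert (He : 0 < e) by (unfold e; lra).
(* The point y satisfies y <= 1 and |K| y < e, hence |K| y^2 < e. *)
set (q := e / (Rabs K + 1)).
assert (HK := Rabs_pos K).
assert (Hq : 0 < q) by (apply Rdiv_lt_0_compat; lra).
assert (Hqe : (Rabs K + 1) * q = e) by (unfold q; field; lra).
set (y := Rmin (Rmin (x / 4) (d / 2)) (Rmin 1 q)).
assert (Hy1 : y <= x / 4)
  by (unfold y; eapply Rle_trans; [apply Rmin_l | apply Rmin_l]).
assert (Hy2 : y <= d / 2)
  by (unfold y; eapply Rle_trans; [apply Rmin_l | apply Rmin_r]).
assert (Hy3 : y <= 1)
  by (unfold y; eapply Rle_trans; [apply Rmin_r | apply Rmin_l]).
assert (Hy4 : y <= q)
  by (unfold y; eapply Rle_trans; [apply Rmin_r | apply Rmin_r]).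
assert (Hy0 : 0 < y) by (unfold y; repeat apply Rmin_pos; lra).
assert (H2 : f y < f (x / 2)) by (apply Hinc; lra).
assert (H3 := Hlow y ltac:(lra)).
assert (HKl := Rle_abs K).
assert (y ^ 2 <= q) by nra.
assert (0 <= y ^ 2) by nra.
assert (K * y ^ 2 <= Rabs K * q) by nra.
unfold e in *; lra.
Qed.

(** * Behaviour near zero *)

(** From [ln z <= z - 1] with [z = tan x / x], and Taylor bounds for
    [sin x / x - cos x] and [cos x]. *)
Lemma ln_tanc_upper x : 0 < x <= 1 ->
  ln_tanc x * (1 - x ^ 2 / 2) <= x ^ 2 / 3 + x ^ 4 / 120.
Proof.
intros Hx; assert (HP := PI2_1).
assert (Hx' : 0 < x < PI / 2) by lra.
destruct (sin_cos_pos x Hx') as [Hs Hc].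
assert (Ht := tanc_pos x Hx').
assert (HL : ln_tanc x <= tan x / x - 1).
{ unfold ln_tanc; generalize (exp_ineq1_le (ln (tan x / x))).
  rewrite exp_ln by easy; lra. }
assert (HS := sin_upper5 x ltac:(lra)).
assert (HC := cos_lower2 x ltac:(lra)).
assert (0 < 1 - x ^ 2 / 2) by nra.
assert (HR : (tan x / x - 1) * cos x <= x ^ 2 / 3 + x ^ 4 / 120).
{ apply Rmult_le_reg_l with x; [lra|].
  replace (x * ((tan x / x - 1) * cos x)) with (sin x - x * cos x)
    by (unfold tan; field; lra).
  assert (x * (1 - x ^ 2 / 2) <= x * cos x) by nra.
  lra. }
destruct (Rle_lt_dec 0 (ln_tanc x)) as [H0|H0].
- apply Rle_trans with (2 := HR).
  apply Rmult_le_compat; lra.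
- assert (0 <= x ^ 2) by nra.
  assert (0 <= x ^ 4) by (apply pow_le; lra).
  nra.
Qed.

Lemma ln_tanc_nonneg x : 0 < x < PI / 2 -> 0 <= ln_tanc x.
Proof.
intros Hx; unfold ln_tanc; rewrite <- ln_1.
apply ln_le; [lra|].
apply Rmult_le_reg_r with x; [lra|].
replace (tan x / x * x) with (tan x) by (field; lra).
destruct (sin_cos_pos x Hx) as [Hs Hc].
assert (H : x * cos x <= sin x).
{ destruct (MVT_cor2 (fun t => sin t - t * cos t) (fun t => t * sin t) 0 x)
    as [c [E Hcx]]; [lra| |].
  - intros c _; apply is_derive_Reals; auto_derive; [easy | ring].
  - rewrite sin_0 in E.
    assert (0 < sin c) by (apply sin_gt_0; lra).
    assert (0 < c * sin c) by nra.
    nra. }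
rewrite Rmult_1_l; unfold tan.
apply Rmult_le_reg_r with (cos x); [easy|].
replace (sin x / cos x * cos x) with (sin x) by (field; lra).
exact H.
Qed.

(** The derivative of the difference is positive because, with [t = 2 x],
    [sin t (1 + t^2/6) <= t (1 - t^2/6 + t^4/120) (1 + t^2/6) < t]; the last
    inequality holds for [t^2 < 14], while [PI^2 < 14]. *)
Lemma ln_tanc_lower x : 0 < x < PI / 2 -> x ^ 2 / 3 < ln_tanc x.
Proof.
intros Hx0.
enough (0 < ln_tanc x - 1 / 3 * x ^ 2) by lra.
revert x Hx0.
apply (increasing_from_zero_pos
         (fun x => ln_tanc x - 1 / 3 * x ^ 2) (PI / 2) (1 / 3) (PI / 2)).
- assert (H := PI2_1); lra.
- apply derive_pos_increasing with (ln_tanc' (1 / 3)).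
  + intros x Hx; now apply is_derive_ln_tanc.
  + intros x Hx; destruct (sin_cos_pos x Hx) as [Hs Hc].
    assert (HP := PI2_upper).
    assert (Hsc : 0 < sin x * cos x) by nra.
    assert (H : sin x * cos x * (1 + 2 / 3 * x ^ 2) < x).
    { assert (H2 := sin_upper5 (2 * x) ltac:(lra)).
      rewrite sin_2a in H2.
      set (p := sin x * cos x) in *.
      assert (Hp : p <= x - 2 / 3 * x ^ 3 + 2 / 15 * x ^ 5)
        by (unfold p; lra).
      apply Rle_lt_trans with
        ((x - 2 / 3 * x ^ 3 + 2 / 15 * x ^ 5) * (1 + 2 / 3 * x ^ 2)).
      - apply Rmult_le_compat_r; nra.
      - assert (0 < x ^ 5) by (apply pow_lt; lra).
        assert (0 < x ^ 5 * (14 / 45 - 4 / 45 * x ^ 2))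
          by (apply Rmult_lt_0_compat; nra).
        nra. }
    unfold ln_tanc'.
    replace (1 / (sin x * cos x) - 1 / x - 2 * (1 / 3) * x)
      with ((x - sin x * cos x * (1 + 2 / 3 * x ^ 2)) / (sin x * cos x * x))
      by (field; lra).
    apply Rdiv_lt_0_compat; nra.
- intros x Hx; assert (H := ln_tanc_nonneg x Hx); lra.
Qed.

(** * Monotonicity of the exponent *)

(** This quantity is [x^3] times the derivative of [ln_tanc x / x^2].  Near [0]
    it is at least [- 2 ln_tanc x >= - 2 x^2], because [sin x cos x <= x], so it
    suffices that it increases. *)
Lemma exponent_slope_pos x : 0 < x < PI / 2 ->
  0 < x * ln_tanc' 0 x - 2 * ln_tanc x.
Proof.
revert x.
apply (increasing_from_zero_pos
         (fun x => x * ln_tanc' 0 x - 2 * ln_tanc x) (PI / 2) 2 1 Rlt_0_1).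
- apply derive_pos_increasing with (fun x =>
    (2 * sin (2 * x) ^ 2 - 2 * x * sin (2 * x) - (2 * x) ^ 2 * cos (2 * x))
    / (x * sin (2 * x) ^ 2)).
  + intros x Hx; destruct (sin_cos_pos x Hx) as [Hs Hc].
    assert (Ht := tanc_pos x Hx).
    unfold ln_tanc, ln_tanc', tan in *; auto_derive.
    * repeat split; nra.
    * rewrite sin_2a, cos_2a.
      assert (E := sin2_cos2 x); unfold Rsqr in E.
      match goal with |- _ = ?r => transitivity
        (r + 2 * (1 - (sin x * sin x + cos x * cos x)) / (sin x * cos x)) end.
      -- field; lra.
      -- rewrite E; field; lra.
  + intros x Hx; assert (Hp := sin_quadratic_pos (2 * x) ltac:(lra)).
    assert (0 < sin (2 * x)) by (apply sin_gt_0; lra).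
    apply Rdiv_lt_0_compat; [lra|].
    apply Rmult_lt_0_compat; [lra|now apply pow_lt].
- intros y Hy; assert (HP := PI2_1).
  assert (Hy' : 0 < y < PI / 2) by lra.
  destruct (sin_cos_pos y Hy') as [Hs Hc].
  assert (HU := ln_tanc_upper y ltac:(lra)).
  assert (H0 := ln_tanc_nonneg y Hy').
  assert (H1 : 0 <= y * ln_tanc' 0 y).
  { unfold ln_tanc'.
    assert (Hsc : sin y * cos y <= y).
    { assert (sin y < y) by (apply sin_lt_x; lra).
      assert (H2 := COS_bound y); nra. }
    replace (y * (1 / (sin y * cos y) - 1 / y - 2 * 0 * y))
      with ((y - sin y * cos y) / (sin y * cos y)) by (field; lra).
    apply Rmult_le_pos; [lra|].
    apply Rlt_le, Rinv_0_lt_compat; nra. }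
  assert (0 <= y ^ 2 <= 1) by nra.
  assert (y ^ 4 <= y ^ 2)
    by (replace (y ^ 4) with (y ^ 2 * y ^ 2) by ring; nra).
  nra.
Qed.

Lemma is_derive_tanc_exponent x : 0 < x < PI / 2 ->
  is_derive (fun y => ln_tanc y / y ^ 2) x
    ((x * ln_tanc' 0 x - 2 * ln_tanc x) / x ^ 3).
Proof.
intros Hx.
apply (is_derive_ext (fun y => (ln_tanc y - 0 * y ^ 2) / y ^ 2)).
{ intros y; now rewrite Rmult_0_l, Rminus_0_r. }
assert (H := is_derive_ln_tanc 0 x Hx).
assert (Hsq : is_derive (fun y : R => y ^ 2) x (2 * x))
  by (auto_derive; [easy | ring]).
assert (Hx2 : x ^ 2 <> 0) by (apply pow_nonzero; lra).
assert (HD := is_derive_div _ _ x _ _ H Hsq Hx2).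
replace ((x * ln_tanc' 0 x - 2 * ln_tanc x) / x ^ 3) with
  ((ln_tanc' 0 x * x ^ 2 - (ln_tanc x - 0 * x ^ 2) * (2 * x)) / (x ^ 2) ^ 2)
  by (field; lra).
exact HD.
Qed.

Lemma tanc_exponent_increasing x y : 0 < x -> x < y -> y < PI / 2 ->
  ln_tanc x / x ^ 2 < ln_tanc y / y ^ 2.
Proof.
revert x y.
apply (derive_pos_increasing _ _ _ _ is_derive_tanc_exponent).
intros x Hx; apply Rdiv_lt_0_compat.
- now apply exponent_slope_pos.
- apply pow_lt; lra.
Qed.

(** * Sharpness and conclusion *)

Lemma exp_lt_inv_tanc c x : 0 < x < PI / 2 ->
  exp (- c * x ^ 2) < x / tan x <-> ln_tanc x / x ^ 2 < c.
Proof.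
intros Hx; rewrite inv_tanc_exp by easy.
assert (0 < x ^ 2) by (apply pow_lt; lra).
rewrite (Rlt_div_l (ln_tanc x) c (x ^ 2)) by easy.
split; intros H1.
- apply exp_lt_inv in H1; lra.
- apply exp_increasing; lra.
Qed.

Lemma inv_tanc_lt_exp c x : 0 < x < PI / 2 ->
  x / tan x < exp (- c * x ^ 2) <-> c < ln_tanc x / x ^ 2.
Proof.
intros Hx; rewrite inv_tanc_exp by easy.
assert (0 < x ^ 2) by (apply pow_lt; lra).
rewrite <- (Rlt_div_r c (ln_tanc x) (x ^ 2)) by easy.
split; intros H1.
- apply exp_lt_inv in H1; lra.
- apply exp_increasing; lra.
Qed.

(** By continuity, the supremum over [(0, x0)] of the increasing exponent is its
    value at [x0]. *)
Lemma tanc_exponent_sup x0 beta : 0 < x0 < PI / 2 ->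
  (forall x, 0 < x < x0 -> ln_tanc x / x ^ 2 < beta) ->
  ln_tanc x0 / x0 ^ 2 <= beta.
Proof.
intros Hx0 Hb; apply Rnot_lt_le; intros Hlt.
assert (Hc : continuous (fun y => ln_tanc y / y ^ 2) x0).
{ apply (ex_derive_continuous (fun y => ln_tanc y / y ^ 2)).
  eexists; now apply is_derive_tanc_exponent. }
destruct (Hc _ (open_gt beta _ Hlt)) as [e He].
assert (He0 := cond_pos e).
set (m := Rmin (x0 / 2) (e / 2)).
assert (m <= x0 / 2) by apply Rmin_l.
assert (m <= e / 2) by apply Rmin_r.
assert (0 < m) by (apply Rmin_pos; lra).
assert (Hm : beta < ln_tanc (x0 - m) / (x0 - m) ^ 2).
{ apply He; unfold ball; simpl; unfold AbsRing_ball, abs, minus, plus, opp; simpl.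
  rewrite Rabs_left; lra. }
specialize (Hb (x0 - m) ltac:(lra)); lra.
Qed.

(** With [d = gamma - 1/3 > 0] and [s = x^2], the upper estimate gives
    [gamma (1 - s/2) < 1/3 + s/120], which fails as soon as
    [s < d / (1 + d)]. *)
Lemma tanc_exponent_inf x0 gamma : 0 < x0 < PI / 2 ->
  (forall x, 0 < x < x0 -> gamma < ln_tanc x / x ^ 2) ->
  gamma <= 1 / 3.
Proof.
intros Hx0 Hg; apply Rnot_lt_le; intros Hlt.
set (d := gamma - 1 / 3).
assert (Hd : 0 < d) by (unfold d; lra).
set (q := d / (1 + d)).
assert (Hq : 0 < q) by (apply Rdiv_lt_0_compat; lra).
assert (Hqd : q * (1 + d) = d) by (unfold q; field; lra).
assert (Hq1 : q < 1) by nra.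
(* As q < 1, the bound x < q already gives x^2 < q. *)
set (x := Rmin (x0 / 2) (q / 2)).
assert (x <= x0 / 2) by apply Rmin_l.
assert (x <= q / 2) by apply Rmin_r.
assert (0 < x) by (apply Rmin_pos; lra).
assert (HU := ln_tanc_upper x ltac:(lra)).
assert (Hx := Hg x ltac:(lra)).
assert (Hs : 0 < x ^ 2) by (apply pow_lt; lra).
apply (Rlt_div_r gamma (ln_tanc x) (x ^ 2) Hs) in Hx.
assert (Hsq : x ^ 2 < q) by nra.
replace (x ^ 4) with (x ^ 2 * x ^ 2) in HU by ring.
set (s := x ^ 2) in *.
assert (Hs1 : gamma * (1 - s / 2) < 1 / 3 + s / 120).
{ apply Rmult_lt_reg_r with s; [easy|].
  apply Rlt_le_trans with (ln_tanc x * (1 - s / 2)); nra. }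
replace gamma with (1 / 3 + d) in Hs1 by (unfold d; ring).
nra.
Qed.

Theorem theorem2p5 (x0 : R) (hx0 : 0 < x0 < PI / 2)
    (b : R) (hb : b = - (1 / x0 ^ 2) * ln (x0 / tan x0)) :
  (forall x : R, 0 < x < x0 ->
     exp (- b * x ^ 2) < x / tan x < exp (- x ^ 2 / 3)) /\
  is_least
    (fun beta : R => forall x : R, 0 < x < x0 ->
       exp (- beta * x ^ 2) < x / tan x) b /\
  is_greatest
    (fun gamma : R => forall x : R, 0 < x < x0 ->
       x / tan x < exp (- gamma * x ^ 2)) (1 / 3).
Proof.
assert (Eb : b = ln_tanc x0 / x0 ^ 2).
{ rewrite hb, inv_tanc_exp, ln_exp by easy; field; lra. }
assert (Hlow : forall x, 0 < x < x0 -> exp (- b * x ^ 2) < x / tan x).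
{ intros x Hx; apply exp_lt_inv_tanc; [lra|].
  rewrite Eb; apply tanc_exponent_increasing; lra. }
assert (Hup : forall x, 0 < x < x0 -> x / tan x < exp (- (1 / 3) * x ^ 2)).
{ intros x Hx; apply inv_tanc_lt_exp; [lra|].
  apply (Rlt_div_r (1 / 3)); [apply Rlt_gt, pow_lt; lra|].
  assert (H := ln_tanc_lower x ltac:(lra)); lra. }
repeat split.
- now apply Hlow.
- replace (- x ^ 2 / 3) with (- (1 / 3) * x ^ 2) by field.
  now apply Hup.
- exact Hlow.
- intros beta Hbeta; rewrite Eb.
  apply tanc_exponent_sup; [easy|].
  intros x Hx; apply exp_lt_inv_tanc; [lra | now apply Hbeta].
- exact Hup.
- intros gamma Hgamma.
  apply (tanc_exponent_inf x0); [easy|].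
  intros x Hx; apply inv_tanc_lt_exp; [lra | now apply Hgamma].
Qed.
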